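(* Let $\mathcal{C}\subset\mathbb{R}^n$ be a full-dimensional compact convex set satisfying the $\delta$-scaling inequality, and let $f:\mathbb{R}^n\to\mathbb{R}$ be a smooth convex function with away curvature $C_f^A$, satisfying the $(\theta,c)$-Hölderian error bound on $\mathcal{C}$. Put $r=\frac{1}{1-\theta}$ and $\mu=\frac{c}{\delta}$, and suppose that $f$ satisfies the $r$-strong Wolfe primal bound on $\mathcal{C}$ with $r>0$. Let $x_0\in\mathcal{C}$ with proper support $\mathcal{S}_0$ satisfy $e^{-\gamma}w(x_0,\mathcal{S}_0)/2\le C_f^A$ for $\gamma=1/2$, and write $w_0=w(x_0,\mathcal{S}_0)$. Run the scheduled restart scheme for the Fractional Away-step Frank-Wolfe algorithm from $(x_0,\mathcal{S}_0)$ with constant schedule parameters $\gamma_k=\gamma=1/2$; let $\hat x$ be its output, $T$ the cumulative number of linear minimization oracle calls over $\mathcal{C}$ (one per inner iteration), and $\bar T=T-|\mathcal{S}_0|$. For $\gamma>0$ let $$C_\gamma^r=\frac{e^{\gamma(2-r)}-1}{16\,e^{2\gamma}\,C_f^A\,\mu\,w(x_0,\mathcal{S}_0)^{r-2}}.$$ Let $\gamma^*(r)$ be the optimal choice of $\gamma>0$ in the (coarser) upper bounds on the primal gap $$w_0\,\frac{1}{\big(1+\bar T C_\gamma^r\big)^{\frac{1}{2-r}}}\ \ (1\le r<2),\qquad w_0\exp\Big(-\frac{\gamma}{e^{2\gamma}}\frac{\bar T}{16\,C_f^A\,\mu}\Big)\ \ (r=2).$$ Then $$f(\hat x)-\min_{\mathcal{C}}f\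 \le\ \sqrt{\frac{e}{4(\sqrt e-1)}}\;w_0\,\frac{1}{\big(1+\bar T\,C_{\gamma^*(r)}^r\big)^{\frac{1}{2-r}}}\quad\text{when }1\le r<2,$$ and, when $r=2$, $\gamma^*(r)=1/2$.
   Context: $\|\cdot\|$ is a fixed norm on $\mathbb{R}^n$; smooth means differentiable with Lipschitz gradient; $X^*=\operatorname{argmin}_{\mathcal{C}}f$, $f^*=\min_{\mathcal{C}}f$. $\operatorname{Ext}(\mathcal{C})$ is the set of extreme points. A finite $\mathcal{S}\subset\operatorname{Ext}(\mathcal{C})$ is a proper support of $x\in\mathcal{C}$ if $x$ is a convex combination of the elements of $\mathcal{S}$ with all weights positive; $\mathcal{S}_x$ is the set of proper supports of $x$. Define $w(x,\mathcal{S})=\max_{y\in\mathcal{S},z\in\mathcal{C}}\nabla f(x)^T(y-z)$ for $\mathcal{S}\in\mathcal{S}_x$, and $w(x)=\min_{\mathcal{S}\in\mathcal{S}_x}w(x,\mathcal{S})$. The $r$-strong Wolfe primal bound on $\mathcal{C}$ with constant $\mu>0$: $f(x)-f^*\le\mu\,w(x)^r$ for all $x\in\mathcal{C}$. Away curvature: $C_f^A=\sup\frac{2}{\eta^2}\big(f(y)-f(x)-\eta\langle\nabla f(x),s-v\rangle\big)$ over $x,s,v\in\mathcal{C}$, $\eta\in(0,1]$, $y=x+\eta(s-v)$. $\delta$-scaling ($\delta=\delta(\mathcal{C})>0$): for every differentiable convex $f$ (with its $X^*$ and $w$) and every $x\in\mathcal{C}\setminus X^*$, $w(x)\ge\delta\max_{x^*\in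 X^*}\langle\nabla f(x),\frac{x-x^*}{\|x-x^*\|}\rangle$. $(\theta,c)$-Hölderian error bound on $\mathcal{C}$ ($\theta\in[0,1/2]$, $c>0$): $\min_{x^*\in X^*}\|x-x^*\|\le c(f(x)-f^* )^\theta$ for all $x\in\mathcal{C}$. Fractional Away-step Frank-Wolfe algorithm. Input: $\gamma>0$, $x_0=\sum_{v\in\mathcal{S}_0}\alpha_0^v v$ with proper support $\mathcal{S}_0$ and positive weights $\alpha_0^v$. Set $t=0$. While $w(x_t,\mathcal{S}_t)>e^{-\gamma}w(x_0,\mathcal{S}_0)$: take an extreme point $v_t\in\operatorname{argmin}_{v\in\mathcal{C}}\nabla f(x_t)^Tv$ (linear minimization oracle), $d_t^{FW}=v_t-x_t$; take $s_t\in\operatorname{argmax}_{v\in\mathcal{S}_t}\nabla f(x_t)^Tv$, $d_t^{Away}=x_t-s_t$. If $-\nabla f(x_t)^Td_t^{FW}>e^{-\gamma}w(x_0,\mathcal{S}_0)/2$, set $d_t=d_t^{FW}$, $\eta_{\max}=1$; otherwise $d_t=d_t^{Away}$, $\eta_{\max}=\alpha_t^{s_t}/(1-\alpha_t^{s_t})$. Set $x_{t+1}=x_t+\eta_td_t$ with $\eta_t\in\operatorname{argmin}_{\eta\in[0,\eta_{\max}]}f(x_t+\eta d_t)$ (exact line search). Update: for a Frank-Wolfe step, multiply all weights by $1-\eta_t$, add $\eta_t$ to the weight of $v_t$, and set $\mathcal{S}_{t+1}=\{v_t\}$ if $\eta_t=1$, else $\mathcal{S}_t\cup\{v_t\}$;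 for an away step, multiply all weights by $1+\eta_t$, subtract $\eta_t$ from the weight of $s_t$, and set $\mathcal{S}_{t+1}=\mathcal{S}_t\setminus\{s_t\}$ if $\eta_t=\eta_{\max}$, else $\mathcal{S}_t$. Then $t\leftarrow t+1$. Output: the first iterate with $w(x_t,\mathcal{S}_t)\le e^{-\gamma}w(x_0,\mathcal{S}_0)$, with its support and weights. Scheduled restarts: given $\epsilon>0$, an iteration budget and parameters $(\gamma_k)$, repeatedly run the Fractional Away-step Frank-Wolfe algorithm to completion, the $k$-th run using parameter $\gamma_k$ and starting from the iterate, support and weights output by run $k-1$ (the first run starting from $x_0,\mathcal{S}_0$), as long as the strong Wolfe gap $w(\cdot,\cdot)$ of the current point exceeds $\epsilon$ and the cumulative number of iterations is below the budget. Output: the output of the last run. *)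

(* Defs.v *)
From HB Require Import structures.
From mathcomp Require Import all_boot all_order all_algebra finmap.
From mathcomp Require Import all_classical all_reals all_analysis.

Set Implicit Arguments.
Unset Strict Implicit.
Unset Printing Implicit Defensive.

Import Order.TTheory GRing.Theory Num.Theory.
Import numFieldNormedType.Exports.

Local Open Scope classical_set_scope.
Local Open Scope ring_scope.

Section Geometry.
Context {R : realType} {n : nat}.
Local Notation V := 'rV[R]_n.

Definition is_norm (N : V -> R) : Prop :=
  [/\ forall x, N x = 0 -> x = 0,
      forall (a : R) x, N (a *: x) = `|a| * N x
    & forall x y, N (x + y) <= N x + N y].

Definition dot (u v : V) : R := \sum_(i < n) u ord0 i * v ord0 i.

Definition grad (f : V -> R) (x : V) : V :=
  \row_(i < n) 'D_(delta_mx ord0 i) f x.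

Definition differentiable_fun (f : V -> R) : Prop :=
  forall x, differentiable f x.

(* The last inequality says that the dual norm of [grad f x - grad f y] is at
   most [L * N (x - y)]. *)
Definition smooth (N : V -> R) (f : V -> R) : Prop :=
  differentiable_fun f /\
  exists L : R, forall x y h : V,
    `|dot (grad f x - grad f y) h| <= L * N (x - y) * N h.

Definition affine_hull (A : set V) : set V :=
  [set x | exists (m : nat) (p : 'I_m -> V) (a : 'I_m -> R),
     [/\ forall i, A (p i), \sum_i a i = 1 & x = \sum_i a i *: p i]].

Definition full_dimensional (A : set V) : Prop := affine_hull A = setT.

Definition extreme_points (C : set V) : set V :=
  [set x | C x /\
     forall y z (t : R), C y -> C z -> 0 < t < 1 ->
       x = t *: y + (1 - t) *: z -> y = x /\ z = x].

(* Weights are functions on the whole space, extended by zero off the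
   support. *)
Definition positive_weights (x : V) (S : {fset V}) (a : V -> R) : Prop :=
  [/\ forall v, v \in S -> 0 < a v,
      forall v, v \notin S -> a v = 0,
      \sum_(v <- S) a v = 1
    & \sum_(v <- S) a v *: v = x].

Definition proper_support (C : set V) (x : V) (S : {fset V}) : Prop :=
  (forall v, v \in S -> extreme_points C v) /\
  exists a : V -> R, positive_weights x S a.

Definition minval (C : set V) (f : V -> R) : R := inf (f @` C).

Definition minimizers (C : set V) (f : V -> R) : set V :=
  [set x | C x /\ forall y, C y -> f x <= f y].

Definition wolfe_gap_at (C : set V) (f : V -> R) (x : V) (S : {fset V}) : R :=
  sup [set d | exists y z : V,
         [/\ y \in S, C z & d = dot (grad f x) (y - z)]].

(* The minimum over all proper supports is taken as an infimum: this set of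
   values is nonempty and bounded below by 0 when [C] is compact and convex and
   [C x], but need not be finite. *)
Definition wolfe_gap (C : set V) (f : V -> R) (x : V) : R :=
  inf [set wolfe_gap_at C f x S | S in [set S | proper_support C x S]].

Definition strong_wolfe_primal_bound (C : set V) (f : V -> R) (r mu : R) :
    Prop :=
  0 < mu /\
  forall x, C x -> f x - minval C f <= mu * (wolfe_gap C f x) `^ r.

(* [x + eta *: (s - v)] is not required to lie in [C]. *)
Definition away_curvature (C : set V) (f : V -> R) : R :=
  sup [set q | exists (x s v : V) (eta : R),
         [/\ C x, C s, C v, 0 < eta <= 1
           & q = 2 / eta ^+ 2 *
                 (f (x + eta *: (s - v)) - f x
                  - eta * dot (grad f x) (s - v))]].

Definition delta_scaling (N : V -> R) (C : set V) (delta : R) : Prop :=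
  0 < delta /\
  forall f : V -> R, differentiable_fun f -> convex_function setT f ->
  forall x, C x -> ~ minimizers C f x ->
    delta * sup [set dot (grad f x) ((N (x - xs))^-1 *: (x - xs))
                | xs in minimizers C f]
      <= wolfe_gap C f x.

Definition hoelderian_error_bound (N : V -> R) (C : set V) (f : V -> R)
    (theta c : R) : Prop :=
  [/\ 0 <= theta <= 1 / 2, 0 < c
    & forall x, C x ->
        inf [set N (x - xs) | xs in minimizers C f]
          <= c * (f x - minval C f) `^ theta].

End Geometry.

Section Algorithm.
Context {R : realType} {n : nat}.
Local Notation V := 'rV[R]_n.

Record afw_state := AfwState {
  afw_point : V;
  afw_support : {fset V};
  afw_weight : V -> R }.

Definition gap_of (C : set V) (f : V -> R) (st : afw_state) : R :=
  wolfe_gap_at C f (afw_point st) (afw_support st).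

Definition lmo (C : set V) (f : V -> R) (x v : V) : Prop :=
  extreme_points C v /\
  forall z, C z -> dot (grad f x) v <= dot (grad f x) z.

Definition away_vertex (f : V -> R) (x : V) (S : {fset V}) (s : V) : Prop :=
  s \in S /\ forall z, z \in S -> dot (grad f x) z <= dot (grad f x) s.

Definition line_search (f : V -> R) (x d : V) (etamax eta : R) : Prop :=
  0 <= eta <= etamax /\
  forall e : R, 0 <= e <= etamax -> f (x + eta *: d) <= f (x + e *: d).

Definition fw_update (st : afw_state) (v : V) (eta : R) : afw_state :=
  AfwState (afw_point st + eta *: (v - afw_point st))
           (if eta == 1 then [fset v]%fset else (v |` afw_support st)%fset)
           (fun u => (1 - eta) * afw_weight st u + eta * (u == v)%:R).

Definition away_update (st : afw_state) (s : V) (etamax eta : R) : afw_state :=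
  AfwState (afw_point st + eta *: (afw_point st - s))
           (if eta == etamax then (afw_support st `\ s)%fset else afw_support st)
           (fun u => (1 + eta) * afw_weight st u - eta * (u == s)%:R).

(* One inner iteration of a run whose target gap is [tau]. It is a relation
   because the oracle, the away vertex and the line search may have several
   solutions. *)
Definition afw_step (C : set V) (f : V -> R) (tau : R)
    (st st' : afw_state) : Prop :=
  let x := afw_point st in
  exists v s : V,
    [/\ lmo C f x v, away_vertex f x (afw_support st) s
      & if tau / 2 < - dot (grad f x) (v - x)
        then exists eta, line_search f x (v - x) 1 eta /\
                         st' = fw_update st v eta
        else let etamax := afw_weight st s / (1 - afw_weight st s) in
             exists eta, line_search f x (x - s) etamax eta /\
                         st' = away_update st s etamax eta].

Inductive afw_loop (C : set V) (f : V -> R) (tau : R) :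
    afw_state -> nat -> afw_state -> Prop :=
| afw_stop st : gap_of C f st <= tau -> afw_loop C f tau st 0 st
| afw_next st st1 k st2 :
    tau < gap_of C f st -> afw_step C f tau st st1 ->
    afw_loop C f tau st1 k st2 -> afw_loop C f tau st k.+1 st2.

(* [fractional_afw C f gamma st k st'] : started at [st] with parameter
   [gamma], the algorithm stops after [k] iterations and outputs [st']. *)
Definition fractional_afw (C : set V) (f : V -> R) (gamma : R)
    (st : afw_state) (k : nat) (st' : afw_state) : Prop :=
  afw_loop C f (expR (- gamma) * gap_of C f st) st k st'.

(* [restarts C f eps budget gamma k m st T out] : with [m] iterations already
   spent in the [k] runs before [st], the scheme outputs [out] after [T]
   iterations in total. *)
Inductive restarts (C : set V) (f : V -> R) (eps : R) (budget : nat)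
    (gamma : nat -> R) :
    nat -> nat -> afw_state -> nat -> afw_state -> Prop :=
| restarts_stop k m st :
    ~ (eps < gap_of C f st /\ (m < budget)%N) ->
    restarts C f eps budget gamma k m st m st
| restarts_run k m st j st1 T out :
    eps < gap_of C f st -> (m < budget)%N ->
    fractional_afw C f (gamma k) st j st1 ->
    restarts C f eps budget gamma k.+1 (m + j) st1 T out ->
    restarts C f eps budget gamma k m st T out.

Definition scheduled_restarts (C : set V) (f : V -> R) (eps : R)
    (budget : nat) (gamma : nat -> R) (st : afw_state) (T : nat)
    (out : afw_state) : Prop :=
  restarts C f eps budget gamma 0 0 st T out.

End Algorithm.

Section Rates.
Context {R : realType}.

Definition rate_const (r CA mu w0 gamma : R) : R :=
  (expR (gamma * (2 - r)) - 1) /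
  (16 * expR (2 * gamma) * CA * mu * w0 `^ (r - 2)).

Definition sublinear_rate (r w0 t K : R) : R :=
  w0 * (1 / (1 + t * K) `^ (1 / (2 - r))).

Definition gap_bound (r CA mu w0 t gamma : R) : R :=
  if r < 2 then sublinear_rate r w0 t (rate_const r CA mu w0 gamma)
  else w0 * expR (- (gamma / expR (2 * gamma) * (t / (16 * CA * mu)))).

(* Minimality is required for all [t >= 0], so that the choice depends only on
   the constants and not on the number of oracle calls of a particular
   execution. For one fixed [t > 0] it would select the same gamma. *)
Definition optimal_gamma (r CA mu w0 gamma : R) : Prop :=
  0 < gamma /\
  forall t g : R, 0 <= t -> 0 < g ->
    gap_bound r CA mu w0 t gamma <= gap_bound r CA mu w0 t g.

End Rates.

(* Main.v *)
Require Import Defs.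
From HB Require Import structures.
From mathcomp Require Import all_boot all_order all_algebra finmap.
From mathcomp Require Import all_classical all_reals all_analysis.
From mathcomp Require Import ring lra.
Import Order.TTheory GRing.Theory Num.Theory.
Import numFieldNormedType.Exports.
Local Open Scope classical_set_scope.
Local Open Scope ring_scope.

(** The two claims about the optimal parameter are one-variable calculus.  For
    [r < 2] the bound decreases with [(e^{g (2 - r)} - 1) / e^{2 g}], which
    strict convexity of the exponential shows to be maximal exactly when
    [e^{g (2 - r)} = 2 / r]; for [r = 2] it decreases with [g / e^{2 g}], which
    is maximal exactly at [1 / 2].

    For the convergence bound, write [h] for the primal gap, [s = 2 - r],
    [rho = e^{1/2}] and [w_k] for the strong Wolfe gap at the start of run [k],
    so that [w_{k+1} <= w_k / rho].  Every iteration of a run with target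
    [tau = w_k / rho] moves along a direction of slope larger than [tau / 2].
    The short step of length [tau / (2 C_f^A)] along it decreases [f] by
    [tau^2 / (8 C_f^A)], and exact line search does as well, except in an away
    step that stops at the end of its segment; such a step removes a vertex
    from the support, and only Frank-Wolfe steps add vertices, one at a time.
    Hence a run that takes [j] iterations from [x] to [x'], with supports [S]
    and [S'], satisfies
    [[
      j + |S'| - |S| <= 16 e C_f^A / w_k^2 * (f x - f x')
    ]]
    ([afw_loop_progress]).

    Bounding [f x - f x'] by [mu * w_k ^ r] in each run and summing a geometric
    series yields the rate with the constant for the parameter [1/2]; comparing
    it with the best parameter afterwards costs the factor [e / (4 (rho - 1))] at
    [r = 1], the square of the factor claimed.  The sharper constant comes from
    keeping the differences [f x - f x'] and summing by parts: what one run uses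
    up of the primal gap is no longer available to the later ones.  This is
    encoded, for any [g > 0] and
    [C_g = (e^{g s} - 1) / (16 e^{2 g} C_f^A mu w0 ^ (- s))], by the potential
    [[
      1 + (m - |S_0| + |S|) C_g + 16 e C_f^A C_g h / w^2
    ]]
    where [m] counts iterations and [w] is the gap at the start of the latest
    run.  A run does not increase it ([potential_run]).  Replacing [w_{k-1}] by
    [w_k] between runs increases it by a multiple of [h], which the primal bound
    [h <= mu * w_k ^ r] controls.  The invariant is that the potential is at
    most [(kappa * rho * w0 / w) ^ s] with [kappa = sqrt (e / (4 (rho - 1)))].
    It reduces to two inequalities for [B = e (e^{g s} - 1) / e^{2 g}], valid
    for every [g > 0]: [1 + B <= (kappa * rho) ^ s] for the first run
    ([first_run_bound]), and a weaker one for the later ones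
    ([later_run_bound]).  The first is where the value of [kappa] is decided: it
    holds because [kappa * rho >= 1 + rho^2 / 4].  As every [g > 0] is allowed,
    the optimal one is in particular. *)

(** * Chords of the exponential function *)

(** The tangent to the exponential at the mean lies below its values at [u] and
    [v], strictly at [u]; averaging the two tangent inequalities cancels the
    linear terms. *)
Lemma expR_strictly_convex (R : realType) (p q u v : R) :
  0 < p -> 0 < q -> p + q = 1 -> u != v ->
  expR (p * u + q * v) < p * expR u + q * expR v.
Proof.
move=> p0 q0 pq uv; set w := p * u + q * v.
have wu : w - u = q * (v - u).
  by rewrite /w (_ : q = 1 - p); [ring | lra].
have shift z : expR z = expR w * expR (z - w).
  by rewrite -expRD; congr expR; ring.
have above_v : expR w * (1 + (v - w)) <= expR v.
  by rewrite (shift v) ler_pM2l ?expR_gt0// expR_ge1Dx.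
have above_u : expR w * (1 + (u - w)) < expR u.
  rewrite (shift u) ltr_pM2l ?expR_gt0// expR_gt1Dx// -opprB oppr_eq0 wu.
  by rewrite mulf_neq0// ?(lt0r_neq0 q0)// subr_eq0 eq_sym.
have -> : expR w = p * (expR w * (1 + (u - w))) + q * (expR w * (1 + (v - w))).
  have -> : q = 1 - p by lra.
  have -> : w = p * u + (1 - p) * v by rewrite /w; congr (_ + _ * _); lra.
  ring.
by apply: ltr_leD; rewrite ?ltr_pM2l// ler_pM2l.
Qed.

(** The chord from [0] to [b * s] bounds the exponential at [a * s]: the map
    [b |-> (e^{b s} - 1) / b] is nondecreasing. *)
Lemma expRB1_chord (R : realType) (a b s : R) : 0 < a -> a <= b ->
  (expR (a * s) - 1) * b <= (expR (b * s) - 1) * a.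
Proof.
move=> a0 ab; have b0 : 0 < b by lra.
have ab1 : a / b <= 1 by rewrite ler_pdivrMr// mul1r.
have := convex_expR (Itv01 (divr_ge0 (ltW a0) (ltW b0)) ab1) (b * s) 0.
rewrite !convRE/= expR0 mulr0 addr0 mulr1 mulrA divfK ?gt_eqF// /unstable.onem.
rewrite -(ler_pM2r b0) => chord.
have eqb : (a / b * expR (b * s) + (1 - a / b)) * b = a * expR (b * s) + b - a.
  by field; rewrite gt_eqF.
by rewrite eqb in chord; lra.
Qed.

(** With [y = e^a] and [z = e^b] this compares the slopes from [1] of the
    concave map [t |-> t ^ s], namely [(z ^ s - 1) / (z - 1)] and
    [(y ^ s - 1) / (y - 1)].  It follows from convexity of [t |-> t ^ (1/s)]. *)
Lemma expRB1_power_chord (R : realType) (a b s : R) :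
  0 < a -> a <= b -> 0 < s <= 1 ->
  (expR (b * s) - 1) * (expR a - 1) <= (expR (a * s) - 1) * (expR b - 1).
Proof.
move=> a0 ab /andP[s0 s1]; have b0 : 0 < b by lra.
set U := expR (a * s); set W := expR (b * s).
have U1 : 1 < U by rewrite /U expR_gt1 mulr_gt0.
have UW : U <= W by rewrite /U /W ler_expR ler_pM2r.
have root x : expR (x * s) `^ s^-1 = expR x.
  by rewrite -expRM mulfK// gt_eqF.
have W1 : 0 < W - 1 by lra.
have l0 : 0 <= (U - 1) / (W - 1) by apply: divr_ge0; lra.
have l1 : (U - 1) / (W - 1) <= 1 by rewrite ler_pdivrMr// mul1r; lra.
have s1V : 1 <= s^-1 by rewrite invf_ge1.
have := @convex_powR R _ s1V (Itv01 l0 l1) W 1.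
rewrite !inE/= !in_itv/= !andbT !convRE/= /unstable.onem powR1.
rewrite [X in X `^ s^-1](_ : _ = U); last first.
  rewrite -[LHS]/((U - 1) / (W - 1) * W + (1 - (U - 1) / (W - 1)) * 1).
  by field; rewrite gt_eqF.
rewrite !root => /(_ (ltW (expR_gt0 _)) ler01).
rewrite -(ler_pM2r W1) => chord.
have eqW : ((U - 1) / (W - 1) * expR b + (1 - (U - 1) / (W - 1)) * 1) * (W - 1)
    = (U - 1) * expR b + W - U by field; rewrite gt_eqF.
by rewrite eqW in chord; lra.
Qed.

(** A bound on [(e^{g s} - 1) / e^{2 g}] that is uniform in both [g] and [s].
    For [g >= b] concavity of powers reduces it to the case [s = 1], where
    [4 (y - 1) <= y ^ 2]; for [g < b] convexity of the exponential reduces it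
    to the limit [s = 0], where [2 e g <= e^{2 g}]. *)
Lemma rate_factor_le (R : realType) (b g s F : R) :
  0 < b -> 0 < g -> 0 < s <= 1 -> 0 <= F ->
  F <= 4 * (expR b - 1) -> F <= 2 * expR 1 * b ->
  F * ((expR (g * s) - 1) / expR (2 * g)) <= expR (b * s) - 1.
Proof.
move=> b0 g0 /andP[s0 s1] F0 Fpow Flin.
rewrite mulrA ler_pdivrMr ?expR_gt0//.
have e2g : expR (2 * g) = expR g * expR g by rewrite -expRD; congr expR; ring.
have gs1 : 0 < expR (g * s) - 1 by rewrite subr_gt0 expR_gt1 mulr_gt0.
have bs1 : 0 < expR (b * s) - 1 by rewrite subr_gt0 expR_gt1 mulr_gt0.
have [gb|/ltW bg] := leP g b.
  have chord := @expRB1_chord R g b s g0 gb.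
  have e2g_ge : 2 * g * expR 1 <= expR (2 * g).
    rewrite [leRHS](_ : _ = expR (2 * g - 1) * expR 1).
      by rewrite ler_pM2r ?expR_gt0//; have := expR_ge1Dx (2 * g - 1); lra.
    by rewrite -expRD; congr expR; ring.
  rewrite -(ler_pM2r b0).
  have le1 : F * ((expR (g * s) - 1) * b) <= F * ((expR (b * s) - 1) * g).
    exact: ler_wpM2l.
  have le2 : F * ((expR (b * s) - 1) * g) <= 2 * expR 1 * b * ((expR (b * s) - 1) * g).
    by apply: ler_wpM2r => //; rewrite mulr_ge0// ltW.
  have le3 : (2 * g * expR 1) * (b * (expR (b * s) - 1)) <=
             expR (2 * g) * (b * (expR (b * s) - 1)).
    by apply: ler_wpM2r => //; rewrite mulr_ge0// ltW.
  by lra.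
have chord := @expRB1_power_chord R b g s b0 bg (introT andP (conj s0 s1)).
have b1 : 0 < expR b - 1 by rewrite subr_gt0 expR_gt1.
have g1 : 0 < expR g - 1 by rewrite subr_gt0 expR_gt1.
have e2g_ge : 4 * (expR g - 1) <= expR (2 * g).
  by rewrite e2g; have := sqr_ge0 (expR g - 2); rewrite expr2; lra.
rewrite -(ler_pM2r b1).
have le1 : F * ((expR (g * s) - 1) * (expR b - 1)) <=
           F * ((expR (b * s) - 1) * (expR g - 1)) by exact: ler_wpM2l.
have le2 : F * ((expR (b * s) - 1) * (expR g - 1)) <=
           4 * (expR b - 1) * ((expR (b * s) - 1) * (expR g - 1)).
  by apply: ler_wpM2r => //; rewrite mulr_ge0// ltW.
have le3 : 4 * (expR g - 1) * ((expR b - 1) * (expR (b * s) - 1)) <=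
           expR (2 * g) * ((expR b - 1) * (expR (b * s) - 1)).
  by apply: ler_wpM2r => //; rewrite mulr_ge0// ltW.
lra.
Qed.

(** * The scalar inequalities behind the restart analysis *)

(** The factor [kappa] that the bound allows for scheduling with the parameter
    [1 / 2] in place of the optimal one. *)
Definition restart_factor (R : realType) : R :=
  Num.sqrt (expR 1 / (4 * (Num.sqrt (expR 1) - 1))).

(** The part of the rate constant that depends on the schedule parameter, with
    [s = 2 - r]. *)
Definition rate_factor {R : realType} (s g : R) : R :=
  (expR (g * s) - 1) / expR (2 * g).

Lemma expR1_sqr (R : realType) : expR 1 = expR (1 / 2) ^+ 2 :> R.
Proof. by rewrite expr2 -expRD; congr expR; lra. Qed.

Lemma sqrt_expR1 (R : realType) : Num.sqrt (expR 1) = expR (1 / 2) :> R.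
Proof. by rewrite expR1_sqr sqrtr_sqr ger0_norm// expR_ge0. Qed.

Lemma expR_half_bounds (R : realType) : 1 < expR (1 / 2 : R) <= 2.
Proof.
apply/andP; split; first by rewrite expR_gt1; lra.
have h : expR (- (1 / 2)) * expR (1 / 2) = 1 :> R by rewrite -expRD addNr expR0.
have h1 : 1 + - (1 / 2) <= expR (- (1 / 2)) :> R by exact: expR_ge1Dx.
have h0 : 0 < expR (1 / 2) :> R by exact: expR_gt0.
have : (1 + - (1 / 2)) * expR (1 / 2) <= expR (- (1 / 2)) * expR (1 / 2) :> R.
  by rewrite ler_pM2r.
lra.
Qed.

(** Both sides are functions of [p = e^{1/2}], and the difference of their
    squares is a positive multiple of [(p - 2) ^ 2 * (4 - p ^ 2 * (p - 1))]; so
    only [1 < p <= 2] matters. *)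
Lemma restart_factor_bound (R : realType) :
  1 + expR 1 / 4 <= restart_factor R * expR (1 / 2).
Proof.
rewrite /restart_factor sqrt_expR1 expR1_sqr.
have /andP[] := @expR_half_bounds R; set p : R := expR (1 / 2) => p1 p2.
have d0 : 0 < p - 1 by lra.
rewrite -(@ler_pXn2r _ 2)// ?nnegrE; first last.
- by rewrite mulr_ge0 ?sqrtr_ge0//; lra.
- by rewrite addr_ge0// divr_ge0// sqr_ge0.
rewrite exprMn sqr_sqrtr; last by rewrite divr_ge0 ?sqr_ge0//; lra.
rewrite -subr_ge0.
have -> : p ^+ 2 / (4 * (p - 1)) * p ^+ 2 - (1 + p ^+ 2 / 4) ^+ 2 =
  (p - 2) ^+ 2 * (4 - p ^+ 2 * (p - 1)) / (16 * (p - 1)).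
  by field; rewrite gt_eqF.
apply: divr_ge0; last by lra.
apply: mulr_ge0; first exact: sqr_ge0.
have : p ^+ 2 * (p - 1) <= 4 * 1.
  apply: ler_pM; rewrite ?sqr_ge0//; last by lra.
    by lra.
  by rewrite expr2; nra.
lra.
Qed.

Lemma restart_factor_ge1 (R : realType) : 1 <= restart_factor R.
Proof.
rewrite /restart_factor sqrt_expR1 expR1_sqr.
have /andP[] := @expR_half_bounds R; set p : R := expR (1 / 2) => p1 p2.
rewrite -[leLHS]sqrtr1 ler_wsqrtr// ler_pdivlMr; last by lra.
by have := sqr_ge0 (p - 2); rewrite !expr2; lra.
Qed.

Lemma rate_factor_ge0 (R : realType) (s g : R) :
  0 < s -> 0 < g -> 0 <= rate_factor s g.
Proof.
move=> s0 g0; rewrite divr_ge0 ?expR_ge0// subr_ge0 ltW// expR_gt1.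
by rewrite mulr_gt0.
Qed.

(** [rate_factor_le] with [e^b] equal to the base on the right.  The
    hypothesis on [4 * (expR b - 1)] is exactly [restart_factor_bound]. *)
Lemma first_run_bound (R : realType) (s g : R) : 0 < s <= 1 -> 0 < g ->
  1 + expR 1 * rate_factor s g <= (restart_factor R * expR (1 / 2)) `^ s.
Proof.
move=> s01 g0; have k1 := @restart_factor_ge1 R.
set b := ln (restart_factor R * expR (1 / 2)).
have k0 : 0 < restart_factor R by lra.
have kp0 : 0 < restart_factor R * expR (1 / 2) by rewrite mulr_gt0 ?expR_gt0.
have eb : expR b = restart_factor R * expR (1 / 2) by rewrite lnK.
have b2 : 1 / 2 <= b.
  by rewrite /b lnM ?posrE ?expR_gt0// expRK lerDr ln_ge0.
have b0 : 0 < b by lra.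
rewrite -eb -expRM -lerBrDl.
apply: rate_factor_le => //.
  by rewrite eb; have := @restart_factor_bound R; lra.
by rewrite mulrAC ler_peMl ?expR_ge0//; lra.
Qed.

(** Here [e^x] is the ratio of two consecutive starting gaps, at least
    [e^{1/2}].  The inequality
    [B * (1 - e^{- (2 - s) x}) <= e^{x s} - 1] is [rate_factor_le] with [b = x];
    it is combined with [1 + B <= D] from [first_run_bound]. *)
Lemma later_run_bound (R : realType) (s g x : R) :
  0 < s <= 1 -> 0 < g -> 1 / 2 <= x ->
  expR 1 * rate_factor s g * (1 - expR (- (2 * x))) <=
  (restart_factor R * expR (1 / 2)) `^ s * (1 - expR (- (x * s))).
Proof.
move=> s01 g0 x2; have /andP[s0 s1] := s01.
have first := @first_run_bound R s g s01 g0.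
set D := _ `^ s in first *; set B := expR 1 * _ in first *.
set E := expR (- (x * s)).
have E0 : 0 < E by exact: expR_gt0.
have EV : E * expR (x * s) = 1 by rewrite -expRD addNr expR0.
have E1 : 0 <= 1 - E.
  by rewrite subr_ge0 expR_le1 oppr_le0 mulr_ge0//; lra.
have B0 : 0 <= B by rewrite mulr_ge0 ?expR_ge0// rate_factor_ge0.
set q := expR (- ((2 - s) * x)).
have qE : q * E = expR (- (2 * x)) by rewrite -expRD; congr expR; ring.
have q0 : 0 < q by exact: expR_gt0.
have q1 : q <= 1.
  by rewrite expR_le1 oppr_le0 mulr_ge0//; lra.
(* The growth of the bound over one run exceeds the growth of the term in the
   primal gap. *)
have growth : B * (1 - q) <= expR (x * s) - 1.
  have -> : B * (1 - q) = expR 1 * (1 - q) * rate_factor s g.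
    by rewrite /B; ring.
  apply: rate_factor_le => //.
  - by lra.
  - by rewrite mulr_ge0 ?expR_ge0//; lra.
  - set y := expR (- x).
    have y0 : 0 < y by exact: expR_gt0.
    have yV : y * expR x = 1 by rewrite -expRD addNr expR0.
    have yq : y ^+ 2 <= q.
      by rewrite expr2 -expRD ler_expR; nra.
    have /andP[] := @expR_half_bounds R; set p : R := expR (1 / 2) => p1 p2.
    have yp : y * p <= 1.
      by rewrite -expRD expR_le1; lra.
    have p1y : p ^+ 2 * y * (1 + y) <= 4.
      have -> : p ^+ 2 * y * (1 + y) = y * p * (p + y * p) by ring.
      have yp0 : 0 <= y * p by rewrite mulr_ge0//; lra.
      by rewrite -[leRHS]mul1r ler_pM//; lra.
    have y1 : y <= 1.
      by rewrite expR_le1; lra.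
    have : p ^+ 2 * (1 - q) <= p ^+ 2 * (1 - y ^+ 2).
      by apply: ler_wpM2l; [exact: sqr_ge0 | lra].
    have : p ^+ 2 * y * (1 + y) * ((1 - y) * expR x) <= 4 * ((1 - y) * expR x).
      by apply: ler_wpM2r => //; rewrite mulr_ge0 ?expR_ge0//; lra.
    rewrite expR1_sqr -/p.
    have -> : p ^+ 2 * y * (1 + y) * ((1 - y) * expR x) =
              (y * expR x) * (p ^+ 2 * (1 - y ^+ 2)) by ring.
    have -> : (1 - y) * expR x = expR x - y * expR x by ring.
    by rewrite yV mul1r; lra.
  - have : expR 1 * (1 - q) <= expR 1 * 1 :> R.
      by apply: ler_wpM2l; rewrite ?expR_ge0//; lra.
    have : expR 1 * 1 <= expR 1 * (2 * x).
      by apply: ler_wpM2l; rewrite ?expR_ge0//; lra.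
    lra.
have : B * (1 - q) * E <= (expR (x * s) - 1) * E by rewrite ler_pM2r.
have -> : (expR (x * s) - 1) * E = E * expR (x * s) - E by ring.
rewrite EV.
have -> : B * (1 - q) * E = B * E - B * (q * E) by ring.
rewrite qE.
have : (1 + B) * (1 - E) <= D * (1 - E) by apply: ler_wpM2r.
lra.
Qed.

(** Changing the reference gap from [wp] to [w] in the potential: the growth of
    the term in the primal gap [h] is absorbed by the growth of the bound
    [(w0 / w) ^ s].  After division by [(w0 / w) ^ s] and the substitution
    [wp = w * e^x], this is [later_run_bound]. *)
Lemma potential_step (R : realType) (s g mu w0 wp w h D K : R) :
  0 < s <= 1 -> 0 < g -> 0 < mu -> 0 < w0 -> 0 < w ->
  w <= expR (- (1 / 2)) * wp -> h <= mu * w `^ (2 - s) ->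
  D = (restart_factor R * expR (1 / 2)) `^ s ->
  K = expR 1 * rate_factor s g * w0 `^ s / mu ->
  D * (w0 / wp) `^ s + K * h * (w ^- 2 - wp ^- 2) <= D * (w0 / w) `^ s.
Proof.
move=> s01 g0 mu0 w00 wgt0 wwp hw DE KE; have /andP[s0 s1] := s01.
have wp0 : 0 < wp.
  by move: (lt_le_trans wgt0 wwp); rewrite pmulr_rgt0// expR_gt0.
set x := ln (wp / w).
have wpE : wp = w * expR x by rewrite lnK ?posrE ?divr_gt0// mulrC divfK// gt_eqF.
have x2 : 1 / 2 <= x.
  rewrite -ler_expR lnK ?posrE ?divr_gt0// ler_pdivlMr//.
  have : expR (1 / 2) * w <= expR (1 / 2) * (expR (- (1 / 2)) * wp).
    by rewrite ler_pM2l ?expR_gt0.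
  by rewrite mulrA -expRD subrr expR0 [1 * wp]mul1r.
have later := @later_run_bound R s g x s01 g0 x2; rewrite -DE in later.
set Q := (w0 / w) `^ s.
have Q0 : 0 < Q by rewrite powR_gt0// divr_gt0.
have -> : (w0 / wp) `^ s = Q * expR (- (x * s)).
  rewrite wpE invfM mulrA -expRN powRM ?expR_ge0 ?divr_ge0 ?(ltW w00) ?(ltW wgt0)//.
  by rewrite -expRM; congr (_ * expR _); ring.
have w2E : w ^- 2 - wp ^- 2 = w ^- 2 * (1 - expR (- (2 * x))).
  by rewrite wpE expRN expRM_natl; field; rewrite !gt_eqF ?expR_gt0.
have x2_0 : 0 <= 1 - expR (- (2 * x)).
  by rewrite subr_ge0 expR_le1; lra.
have w20 : 0 <= w ^- 2 - wp ^- 2.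
  by rewrite w2E mulr_ge0// invr_ge0 sqr_ge0.
have K0 : 0 <= K.
  rewrite KE divr_ge0 ?(ltW mu0)// mulr_ge0 ?powR_ge0//.
  by rewrite mulr_ge0 ?expR_ge0// rate_factor_ge0.
have : K * h * (w ^- 2 - wp ^- 2) <= K * (mu * w `^ (2 - s)) * (w ^- 2 - wp ^- 2).
  by apply: ler_wpM2r => //; apply: ler_wpM2l.
have -> : K * (mu * w `^ (2 - s)) * (w ^- 2 - wp ^- 2) =
   (expR 1 * rate_factor s g * (1 - expR (- (2 * x)))) * Q.
  have Qw : Q * w `^ s = w0 `^ s.
    by rewrite -powRM ?divr_ge0 ?(ltW w00) ?(ltW wgt0)// divfK// gt_eqF.
  rewrite w2E powRB ?(lt0r_neq0 wgt0) ?implybT// -[w `^ 2]/(w `^ 2%:R).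
  rewrite powR_mulrn ?(ltW wgt0)// KE -Qw.
  by field; rewrite ?gt_eqF ?powR_gt0.
have : (expR 1 * rate_factor s g * (1 - expR (- (2 * x)))) * Q <=
       D * (1 - expR (- (x * s))) * Q by rewrite ler_pM2r.
lra.
Qed.

(** * Optimal schedule parameter *)

Lemma rate_constE (R : realType) (r CA mu w0 g : R) :
  rate_const r CA mu w0 g =
  rate_factor (2 - r) g / (16 * CA * mu * w0 `^ (r - 2)).
Proof. by rewrite /rate_const /rate_factor !invfM; ring. Qed.

(** Around the critical point [g0], where [e^{g0 s} = 2 / r], put [g = g0 + t].
    The claim becomes [e^{s t} < (s / 2) e^{2 t} + r / 2], strict convexity of
    the exponential with weights [s / 2] and [r / 2] at [2 t] and [0]. *)
Lemma rate_factor_lt_max (R : realType) (r g : R) : 0 < r < 2 ->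
  g != ln (2 / r) / (2 - r) ->
  rate_factor (2 - r) g < rate_factor (2 - r) (ln (2 / r) / (2 - r)).
Proof.
move=> /andP[r0 r2]; set s := 2 - r; set g0 := ln (2 / r) / s => gg0.
have s0 : 0 < s by rewrite /s; lra.
set t := g - g0; have t0 : t != 0 by rewrite subr_eq0.
have e0 : expR (g0 * s) = 2 / r.
  by rewrite /g0 divfK ?gt_eqF// lnK// posrE divr_gt0.
have gE : g = g0 + t by rewrite /t; ring.
have e2 : expR (2 * g) = expR (2 * g0) * expR (2 * t).
  by rewrite -expRD gE; congr expR; ring.
have es : expR (g * s) = 2 / r * expR (s * t).
  by rewrite -e0 -expRD gE; congr expR; ring.
have := @expR_strictly_convex R (s / 2) (r / 2) (2 * t) 0.
rewrite expR0 mulr0 addr0 !mulr1 mulf_neq0//.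
have -> : s / 2 * (2 * t) = s * t by field.
move=> /(_ ltac:(lra) ltac:(lra) ltac:(rewrite /s; lra) isT) conv.
rewrite /rate_factor e0 es e2 ltr_pdivrMr; last by rewrite mulr_gt0 ?expR_gt0.
rewrite [ltRHS](_ : _ = (2 / r - 1) * expR (2 * t)); last first.
  by field; rewrite !gt_eqF ?expR_gt0.
rewrite -(ltr_pM2l r0).
rewrite (_ : r * _ = 2 * expR (s * t) - r); last by field; rewrite gt_eqF.
rewrite (_ : r * _ = s * expR (2 * t)); last by rewrite /s; field; rewrite gt_eqF.
lra.
Qed.

Lemma linear_factor_lt_max (R : realType) (g : R) : g != 1 / 2 ->
  g / expR (2 * g) < 1 / 2 / expR (2 * (1 / 2)).
Proof.
move=> g2; rewrite [2 * (1 / 2)](_ : _ = 1); last by field.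
rewrite ltr_pdivrMr ?expR_gt0//.
have eg : expR (2 * g) = expR 1 * expR (2 * g - 1) by rewrite -expRD; congr expR; ring.
have : 1 + (2 * g - 1) < expR (2 * g - 1).
  apply: expR_gt1Dx; apply: contra_neq g2 => ?; lra.
rewrite eg (_ : _ * (_ * _) = expR (2 * g - 1) / 2); last first.
  by field; rewrite gt_eqF ?expR_gt0.
lra.
Qed.

Lemma sublinear_rate_lt (R : realType) (r w0 x y : R) : r < 2 -> 0 < w0 ->
  0 <= x < y -> sublinear_rate r w0 1 y < sublinear_rate r w0 1 x.
Proof.
move=> r2 w00 /andP[x0 xy]; rewrite /sublinear_rate !mul1r ltr_pM2l//.
by rewrite ltf_pV2 ?posrE ?powR_gt0 ?gt0_ltr_powR ?invr_gt0 ?nnegrE//; lra.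
Qed.

Lemma sublinear_rate_le (R : realType) (r w0 t x y : R) : r < 2 -> 0 <= w0 ->
  0 <= x <= y -> 0 <= t -> sublinear_rate r w0 t y <= sublinear_rate r w0 t x.
Proof.
move=> r2 w00 /andP[x0 xy] t0; rewrite /sublinear_rate !mul1r ler_wpM2l//.
have tx : 0 <= t * x by rewrite mulr_ge0.
have txy : t * x <= t * y by rewrite ler_wpM2l.
by rewrite lef_pV2 ?posrE ?powR_gt0 ?ge0_ler_powR ?invr_ge0 ?nnegrE//; lra.
Qed.

Lemma optimal_gamma_lt2 (R : realType) (r CA mu w0 g : R) :
  0 < r < 2 -> 0 < CA -> 0 < mu -> 0 < w0 ->
  optimal_gamma r CA mu w0 g <-> g = ln (2 / r) / (2 - r).
Proof.
move=> r02 CA0 mu0 w00; have /andP[r0 r2] := r02.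
set g0 := ln _ / _.
have g00 : 0 < g0.
  rewrite divr_gt0 ?subr_gt0// ln_gt0// ltr_pdivlMr//; lra.
have K0 : 0 < 16 * CA * mu * w0 `^ (r - 2) by rewrite !mulr_gt0 ?powR_gt0.
have C0 x : 0 < x -> 0 <= rate_const r CA mu w0 x.
  by move=> x0; rewrite rate_constE divr_ge0 ?(ltW K0)// rate_factor_ge0// subr_gt0.
have Clt x : x != g0 -> rate_const r CA mu w0 x < rate_const r CA mu w0 g0.
  by move=> xg; rewrite !rate_constE ltr_pM2r ?invr_gt0// rate_factor_lt_max.
rewrite /optimal_gamma /gap_bound r2; split=> [[gpos opt]|->].
  apply/eqP; apply: contraT => gg0; move: (opt 1 g0 ler01 g00).
  by rewrite leNgt sublinear_rate_lt// C0//= Clt.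
split=> // t x t0 x0; apply: sublinear_rate_le => //; first exact: ltW.
rewrite C0//=; have [->//|/Clt/ltW//] := eqVneq x g0.
Qed.

Lemma optimal_gamma_eq2 (R : realType) (CA mu w0 g : R) :
  0 < CA -> 0 < mu -> 0 < w0 ->
  optimal_gamma 2 CA mu w0 g <-> g = 1 / 2.
Proof.
move=> CA0 mu0 w00; rewrite /optimal_gamma /gap_bound ltxx.
split=> [[gpos opt]|->].
  apply/eqP; apply: contraT => /linear_factor_lt_max lt.
  have := opt 1 (1 / 2) ler01 ltac:(lra).
  rewrite ler_pM2l// ler_expR lerN2 ler_pM2r; last first.
    by rewrite divr_gt0// !mulr_gt0.
  by rewrite leNgt lt.
split=> [|t x t0 x0]; first by lra.
rewrite ler_pM2l// ler_expR lerN2 ler_wpM2r//.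
  by rewrite divr_ge0// !mulr_ge0// ltW.
by have [->//|/linear_factor_lt_max/ltW//] := eqVneq x (1 / 2).
Qed.

(** * Convex functions and convex sets of row vectors *)

Section Convexity.
Context {R : realType} {n : nat}.
Local Notation V := 'rV[R]_n.
Implicit Types (C : set V) (f : V -> R) (x y h : V).

Lemma convex_functionE f x y (t : R) : @convex_function R V setT f ->
  0 <= t <= 1 -> f (t *: x + (1 - t) *: y) <= t * f x + (1 - t) * f y.
Proof.
move=> fconv /andP[t0 t1].
by have := fconv (Itv01 t0 t1) x y; rewrite !in_setT; apply.
Qed.

Lemma convex_setE C x y (t : R) : @convex_set R V C ->
  C x -> C y -> 0 <= t <= 1 -> C (t *: x + (1 - t) *: y).
Proof.
move=> Cconv Cx Cy /andP[t0 t1].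
by have := Cconv x y (Itv01 t0 t1); rewrite !inE; apply.
Qed.

(** Normalising by the total weight makes the statement stable under adding one
    point at a time; strict positivity keeps all partial totals invertible. *)
Lemma convex_combination C (r : seq V) (a : V -> R) : @convex_set R V C ->
  (forall v, v \in r -> C v /\ 0 < a v) -> r != [::] ->
  let A := \sum_(v <- r) a v in
  0 < A /\ C (A^-1 *: \sum_(v <- r) a v *: v).
Proof.
move=> Cconv; elim: r => [//|v r IH] Car _ /=.
have [Cv av] := Car v (mem_head v r).
have [->|r0] := eqVneq r [::].
  by rewrite !big_seq1 scalerA mulVf ?gt_eqF// scale1r.
have [||A0 CA] := IH => // [u ur|].
  by apply: Car; rewrite in_cons ur orbT.
rewrite !big_cons; set A := \sum_(_ <- r) a _ in A0 CA *.
set B := \sum_(_ <- r) _ in CA *.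
have D0 : 0 < a v + A by rewrite addr_gt0.
split=> //.
have -> : (a v + A)^-1 *: (a v *: v + B) =
  (a v / (a v + A)) *: v + (1 - a v / (a v + A)) *: (A^-1 *: B).
  rewrite scalerDr !scalerA mulrC; congr (_ + _ *: _).
  by field; rewrite !gt_eqF.
apply: convex_setE => //.
rewrite divr_ge0 ?(ltW av) ?(ltW D0)//= ler_pdivrMr// mul1r lerDl; exact: ltW.
Qed.

Lemma dotDr x y h : dot x (y + h) = dot x y + dot x h.
Proof.
by rewrite /dot -big_split/=; apply: eq_bigr => i _; rewrite mxE mulrDr.
Qed.

Lemma dotZr x (a : R) y : dot x (a *: y) = a * dot x y.
Proof.
rewrite /dot mulr_sumr; apply: eq_bigr => i _; rewrite mxE; ring.
Qed.

Lemma dotNr x y : dot x (- y) = - dot x y.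
Proof. by rewrite -scaleN1r dotZr mulN1r. Qed.

Lemma dotBr x y h : dot x (y - h) = dot x y - dot x h.
Proof. by rewrite dotDr dotNr. Qed.

Lemma dotBl x y h : dot (x - y) h = dot x h - dot y h.
Proof.
by rewrite /dot -sumrB; apply: eq_bigr => i _; rewrite !mxE mulrBl.
Qed.

Lemma dot_sumr x (r : seq V) (a : V -> R) :
  dot x (\sum_(v <- r) a v *: v) = \sum_(v <- r) a v * dot x v.
Proof.
elim: r => [|v r IH]; last by rewrite !big_cons dotDr dotZr IH.
by rewrite !big_nil -[0 in LHS](scale0r 0) dotZr mul0r.
Qed.

Lemma dot_grad f x h : differentiable f x -> dot (grad f x) h = 'D_h f x.
Proof.
move=> df; rewrite deriveE// [in RHS](row_sum_delta h) linear_sum /dot.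
apply: eq_bigr => i _; rewrite linearZ/= mxE deriveE// mulrC.
by rewrite (ord1 (ord0 : 'I_1)).
Qed.

(** The directional derivative is a limit of difference quotients over [t > 0]
    small, each of which convexity bounds by the quotient at [t = 1]. *)
Lemma gradient_inequality f x y : differentiable f x ->
  @convex_function R V setT f -> f x + dot (grad f x) (y - x) <= f y.
Proof.
move=> df fconv; rewrite dot_grad// -lerBrDl /derive.
have cvgd := @diff_derivable _ _ _ _ _ (y - x) df.
rewrite cvg_at_rightE//; apply: limr_le.
  by apply/cvg_ex; exists ('D_(y - x) f x); apply: cvg_dnbhs_at_right.
near=> t.
have t0 : 0 < t by [].
have t1 : t <= 1.
  by near: t; apply: nbhs_right_ltW.
rewrite /= ler_pdivrMl//.
have := @convex_functionE f y x t fconv; rewrite (ltW t0) t1 => /(_ isT).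
have -> : t *: y + (1 - t) *: x = t *: (y - x) + x.
  by rewrite scalerBl scale1r scalerBr -!addrA [x - _]addrC.
lra.
Unshelve. all: by end_near.
Qed.

Lemma is_norm_ge0 (N : V -> R) x : is_norm N -> 0 <= N x.
Proof.
move=> [_ Nz ND]; have := ND x (- x).
rewrite subrr -(scale0r 0) Nz normr0 mul0r -scaleN1r Nz normrN normr1 mul1r.
lra.
Qed.

(** The easy half of the equivalence of norms, by expansion in the standard
    basis; it bounds [N] on compact sets. *)
Lemma norm_bounded (N : V -> R) : is_norm N ->
  exists2 B : R, 0 <= B & forall x (M : R), 0 <= M ->
    (forall i, `|x ord0 i| <= M) -> N x <= B * M.
Proof.
move=> hN; have Nge0 x := @is_norm_ge0 N x hN; have [_ Nz ND] := hN.
have N0 : N 0 = 0 by rewrite -(scale0r 0) Nz normr0 mul0r.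
exists (\sum_(i < n) N (delta_mx ord0 i)); first exact: sumr_ge0.
move=> x M M0 xM; rewrite {1}(row_sum_delta x).
have Nsum (u : 'I_n -> V) : N (\sum_i u i) <= \sum_i N (u i).
  elim/big_rec2: _ => [|i y z _ zy]; first by rewrite N0.
  by apply: le_trans (ND _ _) _; rewrite lerD2l.
apply: le_trans (Nsum _) _; rewrite mulr_suml; apply: ler_sum => i _.
by rewrite Nz mulrC ler_wpM2l.
Qed.

Lemma compact_coord_bounded C : compact C ->
  exists2 M : R, 0 <= M & forall x i, C x -> `|x ord0 i| <= M.
Proof.
move=> /compact_bounded[M [_ /(_ (`|M| + 1))]] H.
exists (`|M| + 1) => [|x i Cx]; first by rewrite addr_ge0.
have /H/(_ x Cx)/= : M < `|M| + 1 by rewrite ltr_pwDr// ler_norm.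
apply: le_trans; rewrite [leRHS](_ : _ = mx_norm x)// mx_normrE.
by apply: (le_bigmax _ (fun ij : 'I_1 * 'I_n => `|x ij.1 ij.2|) (ord0, i)).
Qed.

End Convexity.

(** * Progress along Frank-Wolfe and away directions *)

Section AwayStepFrankWolfe.
Context {R : realType} {n : nat}.
Local Notation V := 'rV[R]_n.
Context (N : V -> R) (C : set V) (f : V -> R).
Context (hN : is_norm N) (hCcompact : compact C) (hCconvex : @convex_set R V C)
  (hfsmooth : smooth N f) (hfconvex : @convex_function R V setT f).
Implicit Types (x y z s v d : V) (S : {fset V}) (st : @afw_state R n).

(** The supremum defining the away curvature is a supremum of a bounded set:
    convexity bounds the Bregman remainder by the variation of the gradient
    between the two points, and Lipschitz continuity makes this quadratic in
    the step.  Points outside [C] are covered since [f] is smooth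
    everywhere. *)
Lemma away_curvature_bound x s v (eta : R) : C x -> C s -> C v ->
  0 < eta <= 1 ->
  f (x + eta *: (s - v)) <=
  f x + eta * dot (grad f x) (s - v) + eta ^+ 2 / 2 * away_curvature C f.
Proof.
move=> Cx Cs Cv eta01; have /andP[eta0 eta1] := eta01.
have [fdiff [L fL]] := hfsmooth.
have [B B0 hB] := norm_bounded _ hN.
have [M M0 hM] := compact_coord_bounded _ hCcompact.
have [_ Nz _] := hN.
rewrite /away_curvature; set E := [set q | _].
have Eub : has_ubound E.
  exists (2 * `|L| * (B * (M + M)) ^+ 2) => _ [y [t [u [e [Cy Ct Cu e01 ->]]]]].
  have /andP[e0 _] := e01; set w := t - u.
  have Nw : N w <= B * (M + M).
    apply: hB => [|i]; first by rewrite addr_ge0.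
    by rewrite !mxE (le_trans (ler_normB _ _))// lerD ?hM.
  have Nw0 := is_norm_ge0 _ w hN.
  have := @gradient_inequality _ _ f (y + e *: w) y (fdiff _) hfconvex.
  rewrite opprD addNKr dotNr dotZr => conv.
  have := le_trans (ler_norm _) (fL (y + e *: w) y w).
  rewrite dotBl addrAC subrr add0r Nz (gtr0_norm e0) => lip.
  have lipL : L * (e * N w) * N w <= `|L| * (e * N w) * N w.
    rewrite !ler_wpM2r// ?ler_norm// mulr_ge0//; exact: ltW.
  have quad : `|L| * (e * N w) * N w <= `|L| * e * (B * (M + M)) ^+ 2.
    rewrite [leLHS](_ : _ = `|L| * e * N w ^+ 2); last by ring.
    by rewrite ler_wpM2l ?mulr_ge0 ?(ltW e0)// ler_sqr ?nnegrE// (le_trans Nw0).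
  rewrite mulrAC ler_pdivrMr ?exprn_gt0//.
  have : e * (dot (grad f (y + e *: w)) w - dot (grad f y) w) <=
         e * (`|L| * e * (B * (M + M)) ^+ 2).
    by rewrite ler_pM2l//; lra.
  lra.
have Emem : E (2 / eta ^+ 2 *
                 (f (x + eta *: (s - v)) - f x
                  - eta * dot (grad f x) (s - v))) by exists x, s, v, eta.
have := ub_le_sup Eub Emem; rewrite mulrAC ler_pdivrMr ?exprn_gt0//.
lra.
Qed.

(** The step [tau / (2 * CA)] minimises the quadratic upper model when the slope
    equals [tau / 2]; the hypothesis [tau / 2 <= CA] makes it admissible. *)
Lemma short_step_decrease x s v (tau CA : R) : CA = away_curvature C f ->
  C x -> C s -> C v -> 0 < tau -> tau / 2 <= CA ->
  tau / 2 < - dot (grad f x) (s - v) ->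
  0 < tau / (2 * CA) <= 1 /\
  f (x + (tau / (2 * CA)) *: (s - v)) <= f x - tau ^+ 2 / (8 * CA).
Proof.
move=> CAE Cx Cs Cv tau0 tauCA slope; have CA0 : 0 < CA by lra.
set e := tau / (2 * CA).
have e0 : 0 < e by rewrite divr_gt0//; lra.
have e1 : e <= 1 by rewrite ler_pdivrMr; lra.
split; first by rewrite e0.
have := @away_curvature_bound x s v e Cx Cs Cv; rewrite e0 e1 -CAE => /(_ isT).
have : e * (tau / 2) <= e * (- dot (grad f x) (s - v)) by rewrite ler_pM2l// ltW.
have -> : tau ^+ 2 / (8 * CA) = e * (tau / 2) - e ^+ 2 / 2 * CA.
  by rewrite /e; field; rewrite gt_eqF.
lra.
Qed.

(** By convexity, a minimiser over a segment that is not its far end is a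
    minimiser over the whole half-line.  This is what allows comparing an away
    step with a short step that would leave [C]. *)
Lemma line_search_global x d (etamax eta e : R) :
  line_search f x d etamax eta -> eta < etamax -> 0 <= e ->
  f (x + eta *: d) <= f (x + e *: d).
Proof.
move=> [/andP[eta0 _] min] etalt e0.
have [le|lt] := leP e etamax; first by apply: min; rewrite e0.
have := min etamax; rewrite lexx (le_trans eta0 (ltW etalt)) => /(_ isT) minmax.
have den : 0 < e - eta by lra.
set t := (e - etamax) / (e - eta).
have t01 : 0 <= t <= 1.
  by rewrite divr_ge0 ?ler_pdivrMr ?mul1r//; lra.
have t1 : t < 1 by rewrite ltr_pdivrMr// mul1r; lra.
have := @convex_functionE _ _ f (x + eta *: d) (x + e *: d) t hfconvex t01.
rewrite !scalerDr !scalerA addrACA -!scalerDl [t + _]addrC subrK scale1r.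
have -> : t * eta + (1 - t) * e = etamax.
  by rewrite /t; field; rewrite gt_eqF.
move=> conv.
have : (1 - t) * f (x + eta *: d) <= (1 - t) * f (x + e *: d) by lra.
by rewrite ler_pM2l//; lra.
Qed.

(** * States of the algorithm and their gaps *)

(** The recorded weights are part of the invariant because the range of an away
    step, hence membership of the next point in [C], depends on them. *)
Definition valid_state st : Prop :=
  (forall v, v \in afw_support st -> extreme_points C v) /\
  positive_weights (afw_point st) (afw_support st) (afw_weight st).

Lemma valid_support_mem st v :
  valid_state st -> v \in afw_support st -> C v.
Proof. by move=> [ext _] /ext[]. Qed.

Lemma valid_point_mem st : valid_state st -> C (afw_point st).
Proof.
move=> [ext [pos _ sum1 <-]].
have [||_] := @convex_combination _ _ C (afw_support st) (afw_weight st) hCconvex.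
- by move=> v vS; split; [have [] := ext v vS | exact: pos].
- apply: contra_eq_neq sum1 => ->.
  by rewrite big_nil eq_sym oner_neq0.
by rewrite sum1 invr1 scale1r.
Qed.

Lemma valid_support_neq0 st : valid_state st ->
  exists y, y \in afw_support st.
Proof.
move=> [_ [_ _ sum1 _]].
have [S0|[y yS]] := fset_0Vmem (afw_support st); last by exists y.
by move: sum1; rewrite S0 big_seq_fset0 => /eqP; rewrite eq_sym oner_eq0.
Qed.

Lemma dot_le_wolfe_gap_at x S y z : (forall v, v \in S -> C v) ->
  y \in S -> C z -> dot (grad f x) (y - z) <= wolfe_gap_at C f x S.
Proof.
move=> SC yS Cz; have [M M0 hM] := compact_coord_bounded _ hCcompact.
rewrite /wolfe_gap_at; set E := [set d | _].
have Eub : has_ubound E.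
  exists (\sum_(i < n) `|grad f x ord0 i| * (M + M)) => _ [u [v [uS Cv ->]]].
  apply: ler_sum => i _; apply: le_trans (ler_norm _) _.
  rewrite normrM ler_wpM2l// !mxE (le_trans (ler_normB _ _))// lerD ?hM//.
  exact: SC.
have Emem : E (dot (grad f x) (y - z)) by exists y, z.
exact: (ub_le_sup Eub Emem).
Qed.

Lemma wolfe_gap_at_ge0 x S y : (forall v, v \in S -> C v) -> y \in S ->
  0 <= wolfe_gap_at C f x S.
Proof.
move=> SC yS; apply: le_trans (dot_le_wolfe_gap_at x S y y SC yS (SC y yS)).
by rewrite dotBr subrr.
Qed.

(** The strong Wolfe gap splits into the Frank-Wolfe gap and the away gap, so
    one of the two directions has slope larger than half of it. *)
Lemma wolfe_gap_at_le x S v s : lmo C f x v -> away_vertex f x S s ->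
  wolfe_gap_at C f x S <= dot (grad f x) (s - v).
Proof.
move=> [[Cv _] vmin] [sS smax]; apply: ge_sup.
  by exists (dot (grad f x) (s - v)), s, v.
by move=> _ [y [z [yS Cz ->]]]; rewrite !dotBr lerB ?smax ?vmin.
Qed.

Lemma gap_ge0 st : valid_state st -> 0 <= gap_of C f st.
Proof.
move=> vst; have [y yS] := valid_support_neq0 st vst.
by apply: wolfe_gap_at_ge0 yS => v; exact: valid_support_mem.
Qed.

(** Writing [x] as the convex combination of its support, the duality gap
    [<grad f x, x - z>] is an average of terms each below the strong Wolfe
    gap. *)
Lemma primal_lower_bound st z : valid_state st -> C z ->
  f (afw_point st) - gap_of C f st <= f z.
Proof.
move=> vst Cz; have [ext [pos _ sum1 xE]] := vst.
have [fdiff _] := hfsmooth; set x := afw_point st; rewrite -/x in xE.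
have := @gradient_inequality _ _ f x z (fdiff x) hfconvex.
suff : dot (grad f x) (x - z) <= gap_of C f st by rewrite !dotBr; lra.
have -> : dot (grad f x) (x - z) =
  \sum_(v <- afw_support st) afw_weight st v * dot (grad f x) (v - z).
  rewrite dotBr -{2}xE dot_sumr.
  under [RHS]eq_bigr do rewrite dotBr mulrBr.
  by rewrite sumrB -mulr_suml sum1 mul1r.
rewrite -[leRHS]mul1r -sum1 mulr_suml big_seq [leRHS]big_seq.
apply: ler_sum => v vS; rewrite ler_wpM2l ?(ltW (pos v vS))//.
by apply: dot_le_wolfe_gap_at => // u; exact: valid_support_mem.
Qed.

Lemma primal_le_gap st : valid_state st ->
  f (afw_point st) - minval C f <= gap_of C f st.
Proof.
move=> vst; rewrite lerBlDl -lerBlDr; apply: lb_le_inf.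
  by exists (f (afw_point st)), (afw_point st) => //; exact: valid_point_mem.
by move=> _ [z Cz <-]; exact: primal_lower_bound.
Qed.

Lemma minval_le st z : valid_state st -> C z -> minval C f <= f z.
Proof.
move=> vst Cz; apply: ge_inf; last by exists z.
exists (f (afw_point st) - gap_of C f st) => _ [y Cy <-].
exact: primal_lower_bound.
Qed.

(** The strong Wolfe primal bound is stated with the infimum over all proper
    supports; the current support is one of them, and all gaps are nonnegative,
    so the infimum is a genuine lower bound. *)
Lemma primal_le_gap_power st (r mu : R) : valid_state st -> 0 <= r ->
  strong_wolfe_primal_bound C f r mu ->
  f (afw_point st) - minval C f <= mu * gap_of C f st `^ r.
Proof.
move=> vst r0 [mu0 /(_ _ (valid_point_mem st vst))/le_trans]; apply.
have [ext wts] := vst; rewrite ler_pM2l// /wolfe_gap.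
set E := [set wolfe_gap_at C f (afw_point st) S | S in _].
have Elb : lbound E 0.
  move=> _ [S [Sext [a [_ _ sum1 _]]] <-].
  have [S0|[y yS]] := fset_0Vmem S.
    by move: sum1; rewrite S0 big_seq_fset0 => /eqP; rewrite eq_sym oner_eq0.
  by apply: wolfe_gap_at_ge0 yS => v /Sext[].
have Emem : E (gap_of C f st).
  by exists (afw_support st) => //; split=> //; exists (afw_weight st).
apply: ge0_ler_powR => //; rewrite ?nnegrE.
- by apply: lb_le_inf => //; exists (gap_of C f st).
- exact: gap_ge0.
- by apply: ge_inf => //; exists 0.
Qed.

(** Both updates of the algorithm rescale the weights and shift the weight of
    one vertex; this computes the new total and the new barycentre at once. *)
Lemma sum_shifted_weights (A : {fset V}) v (a b : V -> R) (c e : R) :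
  v \in A -> (forall u, b u = c * a u + e * (u == v)%:R) ->
  \sum_(u <- A) b u = c * \sum_(u <- A) a u + e /\
  \sum_(u <- A) b u *: u = c *: \sum_(u <- A) a u *: u + e *: v.
Proof.
move=> vA bE; split.
  rewrite (eq_bigr _ (fun u _ => bE u)) big_split/= -mulr_sumr -mulr_sumr; congr (_ + _).
  rewrite (big_fsetD1 v)//= eqxx big1_seq ?addr0 ?mulr1// => u.
  by rewrite !inE => /andP[_ /andP[/negPf->]].
under eq_bigr do rewrite bE scalerDl -!scalerA.
rewrite big_split/= -scaler_sumr -scaler_sumr; congr (_ + _ *: _).
rewrite (big_fsetD1 v)//= eqxx scale1r big1_seq ?addr0// => u.
by rewrite !inE => /andP[_ /andP[/negPf-> _]]; rewrite scale0r.
Qed.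

Lemma fw_update_valid st v (eta : R) : valid_state st ->
  extreme_points C v -> 0 < eta <= 1 -> valid_state (fw_update st v eta).
Proof.
move=> [ext [pos off sum1 xE]] extv /andP[eta0 eta1]; rewrite /fw_update.
have [->|etaN1] := eqVneq eta 1.
  split=> /= [u|]; first by rewrite inE => /eqP->.
  split=> [u|u||]; rewrite /= ?big_seq_fset1 ?inE subrr mul0r add0r mul1r.
  - by move=> ->; exact: ltr01.
  - by move=> /negPf->.
  - by rewrite eqxx.
  - by rewrite eqxx !scale1r addrC subrK.
have eta_lt1 : eta < 1 by rewrite lt_neqAle etaN1.
set S := afw_support st in ext pos off sum1 xE *.
set a := afw_weight st in pos off sum1 xE *.
have sumU (W : lmodType R) (F : V -> W) : (forall u, u \notin S -> F u = 0) ->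
    \sum_(u <- (v |` S)%fset) F u = \sum_(u <- S) F u.
  move=> F0; have [vS|vS] := boolP (v \in S); first by rewrite mem_fset1U.
  by rewrite big_fsetU1//= F0// add0r.
have vU : v \in (v |` S)%fset by rewrite fset1U1.
have [sumE ptE] := @sum_shifted_weights _ v a
  (fun u => (1 - eta) * a u + eta * (u == v)%:R) (1 - eta) eta vU (fun _ => erefl).
split=> /= [u|]; first by rewrite !inE => /orP[/eqP->//|/ext].
split=> /=.
- move=> u; rewrite !inE => uU; have [uv|uv] := eqVneq u v.
    rewrite mulr1 ltr_wpDl// mulr_ge0 ?subr_ge0//.
    by have [/pos/ltW//|/off->] := boolP (u \in S).
  rewrite mulr0 addr0 mulr_gt0 ?subr_gt0// pos//.
  by move: uU; rewrite (negPf uv).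
- move=> u; rewrite !inE negb_or => /andP[/negPf-> /off->].
  by rewrite !mulr0 addr0.
- by rewrite sumE (sumU R^o) ?sum1//; ring.
- rewrite ptE (sumU V) ?xE => [|u /off->]; last by rewrite scale0r.
  by rewrite scalerBr scalerBl scale1r addrA addrAC.
Qed.

Lemma away_update_valid st s (eta : R) (etamax : R) : valid_state st ->
  s \in afw_support st -> afw_weight st s < 1 ->
  etamax = afw_weight st s / (1 - afw_weight st s) -> 0 <= eta <= etamax ->
  valid_state (away_update st s etamax eta).
Proof.
move=> [ext [pos off sum1 xE]]; rewrite /away_update.
set S := afw_support st in ext pos off sum1 xE *.
set a := afw_weight st in pos off sum1 xE *.
move=> sS as1 etamaxE /andP[eta0 etale].
have as0 := pos s sS.
have [sumE ptE] := @sum_shifted_weights _ s a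
  (fun u => (1 + eta) * a u - eta * (u == s)%:R) (1 + eta) (- eta) sS
  ltac:(by move=> u; rewrite mulNr).
rewrite sum1 in sumE; rewrite xE in ptE.
have {}sumE : \sum_(u <- S) ((1 + eta) * a u - eta * (u == s)%:R) = 1.
  by rewrite sumE; ring.
have {}ptE : \sum_(u <- S) ((1 + eta) * a u - eta * (u == s)%:R) *: u =
    afw_point st + eta *: (afw_point st - s).
  by rewrite ptE scalerDl scale1r scalerBr scaleNr addrA.
have other u : u != s -> u \in S -> 0 < (1 + eta) * a u - eta * (u == s)%:R.
  by move=> /negPf-> uS; rewrite mulr0 subr0 mulr_gt0 ?pos//; lra.
have outside u : u \notin S -> (1 + eta) * a u - eta * (u == s)%:R = 0.
  move=> uS; rewrite off// mulr0 (_ : u == s = false) ?mulr0 ?subr0//.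
  by apply: contraNF uS => /eqP->.
have [etaE|etaN] := eqVneq eta etamax.
  have s0 : (1 + eta) * a s - eta * (s == s)%:R = 0.
    by rewrite eqxx mulr1 etaE etamaxE; field; rewrite subr_eq0 gt_eqF.
  split=> /= [u|]; first by rewrite !inE => /andP[_ /ext].
  split=> /=.
  - by move=> u; rewrite !inE => /andP[us uS]; exact: other.
  - move=> u; rewrite !inE negb_and negbK => /orP[/eqP->//|]; exact: outside.
  - by rewrite -[RHS]sumE [RHS](big_fsetD1 s)//= s0 add0r.
  - by rewrite -[RHS]ptE [RHS](big_fsetD1 s)//= s0 scale0r add0r.
split=> //=; split=> //= u uS.
have [->|us] := eqVneq u s; last first.
  by have := other u us uS; rewrite (negPf us).
have : eta < etamax by rewrite lt_neqAle etaN.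
rewrite etamaxE ltr_pdivlMr ?subr_gt0// ?eqxx ?mulr1; lra.
Qed.

(** A vertex of weight one would be the only one in the support, hence equal to
    the current point.  This excludes the division by zero in the maximal length
    of an away step. *)
Lemma away_weight_lt1 st s : valid_state st -> s \in afw_support st ->
  afw_point st != s -> afw_weight st s < 1.
Proof.
move=> [_ [pos _ sum1 xE]] sS; apply: contraNT; rewrite -leNgt => as1.
move: sum1; rewrite (big_fsetD1 s)//=.
have [S0|[u uS]] := fset_0Vmem (afw_support st `\ s)%fset => sum1.
  move: sum1 xE; rewrite S0 big_seq_fset0 addr0 (big_fsetD1 s)//= S0.
  by rewrite big_seq_fset0 addr0 => -> <-; rewrite scale1r.
move: sum1; rewrite (big_fsetD1 u)//= => sum1.
have u0 : 0 < afw_weight st u by apply: pos; move: uS; rewrite inE => /andP[].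
have : 0 <= \sum_(v <- ((afw_support st `\ s) `\ u)%fset) afw_weight st v.
  rewrite big_seq; apply: sumr_ge0 => v; rewrite !inE => /and3P[_ _ vS].
  exact/ltW/pos.
lra.
Qed.

(** * Iteration count of a single run *)

(** The support size is traded against progress.  A Frank-Wolfe step may add one
    vertex, so it is charged twice its decrease; an away step inside its segment
    keeps the support; an away step to the end of its segment may bring no
    decrease, but removes a vertex and makes the left-hand side zero. *)
Lemma afw_step_progress (tau CA : R) st st' : CA = away_curvature C f ->
  0 < tau -> tau / 2 <= CA -> valid_state st -> tau < gap_of C f st ->
  afw_step C f tau st st' ->
  valid_state st' /\
  1 + (#|` afw_support st'|)%:R - (#|` afw_support st|)%:R <=
  16 * CA / tau ^+ 2 * (f (afw_point st) - f (afw_point st')).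
Proof.
move=> CAE tau0 tauCA vst gapst [v [s [lmov aways step]]].
have CA0 : 0 < CA by lra.
have Cx := valid_point_mem st vst.
have [sS _] := aways; have [extv _] := lmov; have [Cv _] := extv.
have Cs := valid_support_mem st s vst sS.
have gap_le := lt_le_trans gapst (wolfe_gap_at_le _ _ _ _ lmov aways).
(* The coefficient on the right is such that a short-step decrease is worth two
   units of the left-hand side. *)
have progress (c z : R) : z <= f (afw_point st) - tau ^+ 2 / (8 * CA) -> c <= 2 ->
    c <= 16 * CA / tau ^+ 2 * (f (afw_point st) - z).
  move=> zle /le_trans; apply.
  rewrite [leLHS](_ : 2 = 16 * CA / tau ^+ 2 * (tau ^+ 2 / (8 * CA))).
    by rewrite ler_wpM2l ?divr_ge0 ?sqr_ge0//; lra.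
  by field; rewrite !gt_eqF.
move: step; case: ifPn => [fw|/negP/negP]; last rewrite -leNgt => fw.
  move=> [eta [[/andP[eta0 eta1] min] ->]].
  have [e01 dec] := @short_step_decrease _ v _ tau CA CAE Cx Cv Cx tau0 tauCA fw.
  have {}dec : f (afw_point st + eta *: (v - afw_point st)) <=
      f (afw_point st) - tau ^+ 2 / (8 * CA).
    have /andP[e0 e1] := e01.
    by apply: le_trans dec; apply: min; rewrite (ltW e0).
  have delta0 : 0 < tau ^+ 2 / (8 * CA) by rewrite divr_gt0 ?exprn_gt0//; lra.
  (* A step of length zero would put a new vertex of weight zero in the
     support. *)
  have etaN0 : eta != 0.
    by apply: contraTneq dec => ->; rewrite scale0r addr0 -ltNge; lra.
  split; first by apply: fw_update_valid => //; rewrite lt_neqAle eq_sym etaN0 eta0.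
  apply: progress => //=.
  have [_|_] := eqVneq eta 1.
    by rewrite cardfs1; have := ler0n R #|` afw_support st|; lra.
  rewrite cardfsU1 natrD.
  have : (v \notin afw_support st)%:R <= 1 :> R by rewrite lern1 leq_b1.
  lra.
move=> [eta [ls ->]]; set etamax := _ / _ in ls *.
have slope : tau / 2 < - dot (grad f (afw_point st)) (afw_point st - s).
  by move: gap_le fw; rewrite !dotBr; lra.
(* A positive slope rules out that the current point is itself the away
   vertex. *)
have xs : afw_point st != s.
  by apply: contraTneq slope => ->; rewrite subrr -[0](scale0r 0) dotZr; lra.
have as1 := away_weight_lt1 st s vst sS xs.
have [eta_in min] := ls.
split; first exact: away_update_valid.
have [etaE|etaN] := eqVneq eta etamax.
  have card : (#|` afw_support st|)%:R =
      1 + (#|` (afw_support st `\ s)%fset|)%:R :> R.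
    by rewrite (cardfsD1 s) sS natrD.
  rewrite card /= etaE eqxx subrr -etaE.
  have /andP[eta0 etam] := eta_in.
  have := min 0; rewrite lexx (le_trans eta0 etam) scale0r addr0 => /(_ isT) dec.
  by rewrite mulr_ge0 ?subr_ge0// divr_ge0 ?sqr_ge0//; lra.
have etalt : eta < etamax.
  by rewrite lt_neqAle etaN; case/andP: eta_in.
have [e01 dec] := @short_step_decrease _ _ s tau CA CAE Cx Cx Cs tau0 tauCA slope.
have e0 := ltW (proj1 (andP e01)).
have {}dec := le_trans (line_search_global _ _ _ _ _ ls etalt e0) dec.
by apply: progress => //=; rewrite (negPf etaN); lra.
Qed.

Lemma afw_loop_progress (tau CA : R) st k st' : CA = away_curvature C f ->
  0 < tau -> tau / 2 <= CA -> afw_loop C f tau st k st' -> valid_state st ->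
  [/\ valid_state st', gap_of C f st' <= tau &
  k%:R + (#|` afw_support st'|)%:R - (#|` afw_support st|)%:R <=
  16 * CA / tau ^+ 2 * (f (afw_point st) - f (afw_point st'))].
Proof.
move=> CAE tau0 tauCA; elim=> {st k st'} [st gapst vst|].
  by split=> //; rewrite add0r !subrr mulr0.
move=> st st1 k st2 gapst step _ IH vst.
have [vst1 prog1] := afw_step_progress _ _ _ _ CAE tau0 tauCA vst gapst step.
have [vst2 gap2 prog2] := IH vst1.
split=> //; rewrite -natr1.
have -> : f (afw_point st) - f (afw_point st2) =
  (f (afw_point st) - f (afw_point st1)) + (f (afw_point st1) - f (afw_point st2)).
  by ring.
rewrite mulrDr; lra.
Qed.

Lemma restarts_stop_or_run (eps : R) budget (gam : nat -> R) k m st T out :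
  restarts C f eps budget gam k m st T out ->
  (T = m /\ out = st) \/
  exists j st1, [/\ eps < gap_of C f st, fractional_afw C f (gam k) st j st1
                 & restarts C f eps budget gam k.+1 (m + j) st1 T out].
Proof.
case=> {k m st T out} [k m st _|k m st j st1 T out gapeps _ run rest].
  by left.
by right; exists j, st1.
Qed.

(** * The potential across restarts *)

Section RestartedRuns.
Context (r mu g w0 : R) (st0 : @afw_state R n).
Context (r12 : 1 <= r < 2) (g0 : 0 < g) (w0_gt0 : 0 < w0).
Context (hWolfe : strong_wolfe_primal_bound C f r mu).
Context (hinit : expR (- (1 / 2)) * w0 / 2 <= away_curvature C f).

Let CA := away_curvature C f.
Let K := rate_const r CA mu w0 g.
Let D := (restart_factor R * expR (1 / 2)) `^ (2 - r).

(** The last term is the progress still to be made, priced at the rate of the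
    latest run, which started with gap [w]. *)
Definition potential (m : nat) st (w : R) : R :=
  1 + (m%:R - (#|` afw_support st0|)%:R + (#|` afw_support st|)%:R) * K +
  16 * expR 1 * CA * K / w ^+ 2 * (f (afw_point st) - minval C f).

(** The point is the output of a run that started with gap [wp].  The potential
    refers to [wp] and not to the current gap, which may vanish. *)
Definition after_run (m : nat) st : Prop :=
  valid_state st /\ exists wp,
    [/\ 0 < wp <= w0, gap_of C f st <= expR (- (1 / 2)) * wp
      & potential m st wp <= D * (w0 / wp) `^ (2 - r)].

Let CA_gt0 : 0 < CA.
Proof.
apply: lt_le_trans hinit.
by rewrite divr_gt0// mulr_gt0// expR_gt0.
Qed.

Let mu_gt0 : 0 < mu. Proof. by have [] := hWolfe. Qed.

Let s01 : 0 < 2 - r <= 1. Proof. by case/andP: r12 => ? ?; lra. Qed.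

Let K_ge0 : 0 <= K.
Proof.
have /andP[s0 _] := s01.
by rewrite /K rate_constE divr_ge0 ?rate_factor_ge0// !mulr_ge0 ?powR_ge0 ?ltW.
Qed.

Let K_coef : 16 * expR 1 * CA * K =
  expR 1 * rate_factor (2 - r) g * w0 `^ (2 - r) / mu.
Proof.
rewrite /K rate_constE -(opprB 2 r) powRN.
by field; rewrite !gt_eqF ?powR_gt0.
Qed.

(** The iterations of a run are paid for by the decrease of the last term of the
    potential, by [afw_loop_progress] with target [e^{-1/2} * w]. *)
Lemma potential_run m st w j st' : valid_state st -> w = gap_of C f st ->
  0 < w <= w0 -> fractional_afw C f (1 / 2) st j st' ->
  [/\ valid_state st', gap_of C f st' <= expR (- (1 / 2)) * w
    & potential (m + j) st' w <= potential m st w].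
Proof.
move=> vst wE /andP[wpos ww0]; rewrite /fractional_afw -wE => run.
have tau0 : 0 < expR (- (1 / 2)) * w by rewrite mulr_gt0 ?expR_gt0.
have tauCA : expR (- (1 / 2)) * w / 2 <= CA.
  by apply: le_trans hinit; rewrite ler_pM2r// ler_pM2l ?expR_gt0.
have [vst' gap' prog] := afw_loop_progress _ _ _ _ _ erefl tau0 tauCA run vst.
split=> //; rewrite /potential natrD -/CA.
move: prog.
have -> : 16 * away_curvature C f / (expR (- (1 / 2)) * w) ^+ 2 =
          16 * expR 1 * CA / w ^+ 2.
  rewrite exprMn -expRM_natl (_ : 2%:R * _ = - 1) ?expRN; last by field.
  by rewrite /CA; field; rewrite !gt_eqF ?expR_gt0.
move=> /(ler_wpM2r K_ge0).
have -> : 16 * expR 1 * CA * K / w ^+ 2 = 16 * expR 1 * CA / w ^+ 2 * K by ring.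
set h := f (afw_point st); set h' := f (afw_point st'); set c := _ / w ^+ 2.
have -> : c * (h - h') * K = c * K * h - c * K * h' by ring.
rewrite !mulrDl !mulNr !mulrBr; lra.
Qed.

(** Before the first run the primal bound turns the potential into [1 + B] or
    less. *)
Lemma potential_start : valid_state st0 -> w0 = gap_of C f st0 ->
  potential 0 st0 w0 <= D * (w0 / w0) `^ (2 - r).
Proof.
move=> vst0 w0E; rewrite divff ?gt_eqF// powR1 mulr1.
have first := @first_run_bound R (2 - r) g s01 g0.
have /andP[r1 r2] := r12.
have hle := primal_le_gap_power st0 r mu vst0 ltac:(lra) hWolfe.
apply: le_trans first; rewrite /potential sub0r addNr mul0r addr0 lerD2l K_coef.
rewrite -w0E in hle.
have coef0 : 0 <= expR 1 * rate_factor (2 - r) g * w0 `^ (2 - r) / mu / w0 ^+ 2.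
  have /andP[s0 _] := s01.
  rewrite !divr_ge0 ?sqr_ge0 ?(ltW mu_gt0)// mulr_ge0 ?powR_ge0//.
  by rewrite mulr_ge0 ?expR_ge0// rate_factor_ge0.
apply: le_trans (ler_wpM2l coef0 hle) _.
rewrite powRB ?(lt0r_neq0 w0_gt0) ?implybT// -[w0 `^ 2]/(w0 `^ 2%:R).
rewrite powR_mulrn ?(ltW w0_gt0)//.
rewrite le_eqVlt; apply/orP; left; apply/eqP.
by field; rewrite !gt_eqF ?powR_gt0.
Qed.

Lemma potential_between_runs m st : after_run m st -> 0 < gap_of C f st ->
  potential m st (gap_of C f st) <= D * (w0 / gap_of C f st) `^ (2 - r).
Proof.
move=> [vst [wp [/andP[wp0 _] gapwp pot]]] gap0.
have /andP[r1 r2] := r12.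
have hle := primal_le_gap_power st r mu vst ltac:(lra) hWolfe.
have step := @potential_step R (2 - r) g mu w0 wp (gap_of C f st)
  (f (afw_point st) - minval C f) D _ s01 g0 mu_gt0 w0_gt0 gap0 gapwp.
have rE : 2 - (2 - r) = r by ring.
rewrite rE in step; apply: le_trans (step _ hle erefl erefl).
move: pot; rewrite /potential -K_coef; lra.
Qed.

Lemma after_run_next m st j st' : after_run m st -> 0 < gap_of C f st ->
  fractional_afw C f (1 / 2) st j st' -> after_run (m + j) st'.
Proof.
move=> ar gap0 run; have [vst [wp [/andP[wp0 wpw0] gapwp _]]] := ar.
have w01 : 0 < gap_of C f st <= w0.
  rewrite gap0; apply: le_trans gapwp (le_trans _ wpw0).
  by apply: ler_piMl (ltW wp0) _; rewrite expR_le1; lra.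
have [vst' gap' pot] := potential_run m st _ j st' vst erefl w01 run.
split=> //; exists (gap_of C f st); split=> //.
exact: le_trans pot (potential_between_runs m st ar gap0).
Qed.

Lemma restarts_after_run (eps : R) budget k m st T out : 0 <= eps ->
  restarts C f eps budget (fun _ => 1 / 2) k m st T out ->
  after_run m st -> after_run T out.
Proof.
move=> eps0; elim=> {k m st T out} // k m st j st1 T out gapeps _ run _ IH ar.
by apply: IH; apply: after_run_next run => //; exact: le_lt_trans gapeps.
Qed.

(** Dropping the nonnegative terms of the potential leaves
    [1 + u * K <= (kappa * e^{1/2} * w0 / wp) ^ (2 - r)], and the primal gap is
    at most the current gap, hence at most [e^{-1/2} * wp]. *)
Lemma after_run_rate m st :
  let u := (m%:R - (#|` afw_support st0|)%:R) in
  after_run m st -> 0 < 1 + u * K ->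
  f (afw_point st) - minval C f <= restart_factor R * sublinear_rate r w0 u K.
Proof.
move=> u [vst [wp [/andP[wp0 _] gapwp pot]]] u0.
have /andP[s0 _] := s01.
have k0 : 0 < restart_factor R := lt_le_trans ltr01 (restart_factor_ge1 R).
set b := restart_factor R * expR (1 / 2) * (w0 / wp).
have b0 : 0 < b by rewrite !mulr_gt0 ?expR_gt0 ?invr_gt0.
have h0 : 0 <= f (afw_point st) - minval C f.
  by rewrite subr_ge0 (minval_le st)//; exact: valid_point_mem.
have uK : 1 + u * K <= b `^ (2 - r).
  rewrite powRM ?divr_ge0 ?(ltW w0_gt0) ?(ltW wp0) ?mulr_ge0 ?expR_ge0 ?(ltW k0)//.
  apply: le_trans pot; rewrite /potential -/u [(u + _) * K]mulrDl.
  have SK : 0 <= (#|` afw_support st|)%:R * K by rewrite mulr_ge0.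
  have : 0 <= 16 * expR 1 * CA * K / wp ^+ 2 * (f (afw_point st) - minval C f).
    rewrite mulr_ge0// divr_ge0 ?sqr_ge0// mulr_ge0//.
    by rewrite !mulr_ge0 ?expR_ge0// ltW.
  by lra.
have root : (1 + u * K) `^ (1 / (2 - r)) <= b.
  rewrite -[leRHS](_ : (b `^ (2 - r)) `^ (1 / (2 - r)) = _); last first.
    by rewrite -powRrM mul1r divff ?gt_eqF// powRr1// ltW.
  by rewrite ge0_ler_powR ?nnegrE ?powR_ge0 ?(ltW u0) ?divr_ge0 ?(ltW s0).
apply: le_trans (primal_le_gap st vst) _; apply: le_trans gapwp _.
have p0 : 0 < (1 + u * K) `^ (1 / (2 - r)) by rewrite powR_gt0.
rewrite /sublinear_rate mulrA (div1r (_ `^ _)) ler_pdivlMr//.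
apply: le_trans (ler_wpM2l _ root) _; first by rewrite mulr_ge0 ?expR_ge0// ltW.
rewrite le_eqVlt; apply/orP; left; apply/eqP; rewrite /b expRN.
by field; rewrite !gt_eqF ?expR_gt0.
Qed.

(** If the scheme stops before its first run then [u <= 0], and the bound
    exceeds [w0] because [kappa >= 1]. *)
Lemma scheduled_restarts_rate (eps : R) budget T out :
  let u := (T%:R - (#|` afw_support st0|)%:R) in
  0 < eps -> valid_state st0 -> w0 = gap_of C f st0 ->
  scheduled_restarts C f eps budget (fun _ => 1 / 2) st0 T out ->
  0 < 1 + u * K ->
  f (afw_point out) - minval C f <= restart_factor R * sublinear_rate r w0 u K.
Proof.
move=> u eps0 vst0 w0E run u0; have /andP[s0 _] := s01.
have k1 := restart_factor_ge1 R.
have [[T0 ->]|[j [st1 [_ run1 rest]]]] := restarts_stop_or_run _ _ _ _ _ _ _ _ run.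
  apply: le_trans (primal_le_gap _ vst0) _; rewrite -w0E.
  have p1 : (1 + u * K) `^ (1 / (2 - r)) <= 1.
    rewrite [leRHS](_ : 1 = 1 `^ (1 / (2 - r))); last by rewrite powR1.
    rewrite ge0_ler_powR ?nnegrE ?(ltW u0) ?divr_ge0 ?(ltW s0)//.
    by rewrite gerDl /u T0 sub0r mulNr oppr_le0 mulr_ge0.
  rewrite /sublinear_rate mulrCA ler_peMr ?(ltW w0_gt0)//.
  rewrite (div1r (_ `^ _)) ler_pdivlMr ?powR_gt0// [leLHS]mul1r.
  exact: le_trans p1 k1.
apply: after_run_rate u0.
have w01 : 0 < w0 <= w0 by rewrite w0_gt0 lexx.
have [vst1 gap1 pot1] := potential_run 0 st0 w0 j st1 vst0 w0E w01 run1.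
apply: restarts_after_run (ltW eps0) rest _; split=> //.
by exists w0; split=> //; apply: le_trans pot1 (potential_start vst0 w0E).
Qed.

End RestartedRuns.

End AwayStepFrankWolfe.

(** * The restarted algorithm *)

Theorem proposition5p3 (R : realType) (n : nat)
  (N : 'rV[R]_n -> R) (hN : is_norm N)
  (C : set 'rV[R]_n) (hCfull : full_dimensional C) (hCcompact : compact C)
  (hCconvex : @convex_set R 'rV[R]_n C)
  (delta : R) (hdelta : delta_scaling N C delta)
  (f : 'rV[R]_n -> R) (hfsmooth : smooth N f)
  (hfconvex : @convex_function R 'rV[R]_n setT f)
  (theta c : R) (hHEB : hoelderian_error_bound N C f theta c)
  (r mu : R) (hr : r = 1 / (1 - theta)) (hmu : mu = c / delta)
  (hrpos : 0 < r) (hWolfe : strong_wolfe_primal_bound C f r mu)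
  (CA : R) (hCA : CA = away_curvature C f)
  (x0 : 'rV[R]_n) (S0 : {fset 'rV[R]_n}) (alpha0 : 'rV[R]_n -> R)
  (hx0 : C x0) (hS0 : proper_support C x0 S0)
  (halpha0 : positive_weights x0 S0 alpha0)
  (w0 : R) (hw0 : w0 = wolfe_gap_at C f x0 S0)
  (hinit : expR (- (1 / 2)) * w0 / 2 <= CA)
  (eps : R) (heps : 0 < eps) (budget : nat)
  (T : nat) (out : @afw_state R n)
  (hrun : scheduled_restarts C f eps budget (fun _ : nat => 1 / 2)
            (AfwState x0 S0 alpha0) T out)
  (Tbar : R) (hTbar : Tbar = T%:R - (#|` S0|)%:R) :
  (0 < w0 -> exists! gs : R, optimal_gamma r CA mu w0 gs) /\
  (forall gs : R, optimal_gamma r CA mu w0 gs ->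
     1 <= r < 2 ->
     0 < 1 + Tbar * rate_const r CA mu w0 gs ->
     f (afw_point out) - minval C f <=
       Num.sqrt (expR 1 / (4 * (Num.sqrt (expR 1) - 1))) *
       sublinear_rate r w0 Tbar (rate_const r CA mu w0 gs)) /\
  (r = 2 -> 0 < w0 ->
     forall gs : R, optimal_gamma r CA mu w0 gs -> gs = 1 / 2).
Proof.
have vst0 : valid_state C (AfwState x0 S0 alpha0) by case: hS0.
have gap0 := gap_ge0 _ f hCcompact _ vst0.
have w0E : w0 = gap_of C f (AfwState x0 S0 alpha0) by [].
rewrite -w0E in gap0.
have mu0 : 0 < mu by have [] := hWolfe.
have CA0 : 0 < w0 -> 0 < CA.
  by move=> w00; apply: lt_le_trans hinit; rewrite divr_gt0// mulr_gt0// expR_gt0.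
have r12 : 1 <= r <= 2.
  have [/andP[th0 th1] _ _] := hHEB.
  by rewrite hr ler_pdivlMr ?ler_pdivrMr; lra.
have /andP[r1 r2] := r12.
split; last split.
- move=> w00; have [rE|rlt2] := eqVneq r 2.
    rewrite rE; exists (1 / 2); split; first by apply/optimal_gamma_eq2; auto.
    by move=> g /optimal_gamma_eq2 ->; auto.
  have r02 : 0 < r < 2 by rewrite hrpos lt_neqAle rlt2.
  exists (ln (2 / r) / (2 - r)); split; first by apply/optimal_gamma_lt2; auto.
  by move=> g /optimal_gamma_lt2 ->; auto.
- move=> gs [gs0 _] rlt2 pos.
  have [w00|w00] := ltP 0 w0.
    rewrite hTbar hCA in pos *.
    apply: (scheduled_restarts_rate N C f hN hCcompact hCconvex hfsmooth hfconvex
      r mu gs w0 (AfwState x0 S0 alpha0) rlt2 gs0 w00 hWolfe _ eps budget T out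
      heps vst0 w0E hrun) => //.
    by rewrite -hCA.
  (* With a vanishing initial gap no run is started and [x0] is optimal. *)
  have {w00}w00 : w0 = 0 by apply/eqP; rewrite eq_le w00.
  have [[_ ->]|[j [st1 [gapeps _ _]]]] := restarts_stop_or_run _ _ _ _ _ _ _ _ _ _ hrun.
    apply: le_trans (primal_le_gap N C f hCcompact hCconvex hfsmooth hfconvex _ vst0) _.
    by rewrite -w0E w00 /sublinear_rate mul0r mulr0.
  by move: (lt_trans heps gapeps); rewrite -w0E w00 ltxx.
- move=> rE w00 gs; rewrite rE => /optimal_gamma_eq2; apply; auto.
Qed.
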